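(* Let $k$ be a commutative ring and suppose that $A$ and $B$ are two $k$-algebras which are right (resp., left) perfect and periodic rings. Then the tensor product $k$-algebra $A\otimes_k B$ is periodic as a ring.
   Context: All rings and algebras are associative with identity (not necessarily commutative unless stated). A ring $R$ is periodic if for every $x\in R$ there exist distinct positive integers $m\neq n$ with $x^m=x^n$. $J(R)$ is the Jacobson radical. A ring $R$ is right perfect if $R/J(R)$ is semisimple (Artinian) and for every sequence $a_1,a_2,\ldots$ of elements of $J(R)$ there is an integer $l\ge 1$ with $a_1a_2\cdots a_l=0$; left perfect is the left-right symmetric notion (with $a_l\cdots a_2a_1=0$). *)

(* Defs.v *)
From HB Require Import structures.
From mathcomp Require Import all_boot all_order all_algebra.
From mathcomp Require Import boolp classical_sets.

Set Implicit Arguments.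
Unset Strict Implicit.
Unset Printing Implicit Defensive.

Import GRing.Theory.

Local Open Scope ring_scope.
Local Open Scope quotient_scope.
Local Open Scope classical_set_scope.

(* Rings are [pzRingType]s, so that the zero ring is allowed.  The library's
   [algType] insists on 1 != 0; a [pzAlgType k] is a possibly zero ring together
   with its structure morphism from k to the centre, the action of c : k on x
   being [kmap c * x]. *)
HB.mixin Record PzRing_isPzAlgebra (k : comPzRingType) A of GRing.PzRing A := {
  kmap : {rmorphism k -> A};
  kmap_comm : forall (c : k) (x : A), kmap c * x = x * kmap c
}.

#[short(type="pzAlgType")]
HB.structure Definition PzAlgebra (k : comPzRingType) :=
  {A of GRing.PzRing A & PzRing_isPzAlgebra k A}.

Section AlgebraIsPzAlgebra.
Variables (k : comPzRingType) (A : algType k).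

Fact in_alg_comm (c : k) (x : A) : c%:A * x = x * c%:A.
Proof. by rewrite -scalerAl mul1r -scalerAr mulr1. Qed.

HB.instance Definition _ :=
  @PzRing_isPzAlgebra.Build k A (in_alg A : {rmorphism k -> A}) in_alg_comm.

Lemma kmap_algE (c : k) (x : A) : kmap c * x = c *: x.
Proof. exact: mulr_algl. Qed.

End AlgebraIsPzAlgebra.

Definition periodic (R : pzRingType) : Prop :=
  forall x : R, exists m n : nat,
    [/\ (0 < m)%N, (0 < n)%N, m <> n & x ^+ m = x ^+ n].

Section Ideals.
Variable R : pzRingType.
Implicit Types I K M N : set R.

Definition right_ideal I : Prop :=
  [/\ I 0, forall x y, I x -> I y -> I (x - y)
    & forall x r, I x -> I (x * r)].

Definition maximal_right_ideal M : Prop :=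
  [/\ right_ideal M, M <> setT
    & forall N, right_ideal N -> M `<=` N -> N = M \/ N = setT].

Definition jacobson : set R :=
  \bigcap_(M in [set M | maximal_right_ideal M]) M.

(* The right module R_R is semisimple: every submodule is a direct summand. *)
Definition semisimple : Prop :=
  forall I, right_ideal I ->
    exists K, [/\ right_ideal K, I `&` K = [set 0]
      & forall x, exists y z, [/\ I y, K z & x = y + z]].

Lemma right_idealN I x : right_ideal I -> I x -> I (- x).
Proof. by case=> I0 IB _ Ix; rewrite -sub0r; apply: IB. Qed.

Lemma right_idealD I x y : right_ideal I -> I x -> I y -> I (x + y).
Proof.
move=> iI Ix Iy; case: (iI) => _ IB _.
by rewrite -(opprK y); apply: IB => //; apply: right_idealN.
Qed.

Lemma right_ideal_jacobson : right_ideal jacobson.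
Proof.
split=> [M [[]] // |x y Jx Jy M mM|x r Jx M mM].
  by case: (mM) => -[_ MB _] _ _; apply: MB; [apply: Jx|apply: Jy].
by case: (mM) => -[_ _ MM] _ _; apply: MM; apply: Jx.
Qed.

Lemma maximal_right_ideal_colon M r : maximal_right_ideal M -> ~ M r ->
  maximal_right_ideal [set y | M (r * y)].
Proof.
move=> [iM _ maxM] nMr; case: (iM) => M0 MB MM; split.
- split=> [|x y|x s] /=; rewrite ?mulr0 ?mulrBr ?mulrA //; first exact: MB.
  exact: MM.
- move=> eT; apply: nMr; rewrite -[r]mulr1.
  by have : [set y | M (r * y)] 1 by rewrite eT.
move=> K iK sK; case: (iK) => K0 KB KM.
have [sKM|/existsNP[u /not_implyP[Ku nMu]]] :=
  pselect (forall u, K u -> M (r * u)).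
  by left; apply/seteqP; split.
right; apply/seteqP; split=> // y _.
pose N := [set v | exists s m, M m /\ v = r * u * s + m].
have iN : right_ideal N.
  split=> [|_ _ [s [m [Mm ->]]] [s' [m' [Mm' ->]]]|_ t [s [m [Mm ->]]]].
  - by exists 0, 0; rewrite mulr0 addr0.
  - exists (s - s'), (m - m'); split; first exact: MB.
    by rewrite mulrBr opprD addrACA.
  - by exists (s * t), (m * t); split; [apply: MM|rewrite mulrDl !mulrA].
have sMN : M `<=` N by move=> m Mm; exists 0, m; rewrite mulr0 add0r.
have [eNM|eNT] := maxM N iN sMN.
  by case: nMu; rewrite -eNM; exists 1, 0; rewrite mulr1 addr0.
have [s [m [Mm eq_y]]] : N (r * y) by rewrite eNT.
rewrite -(subrK (u * s) y); apply: right_idealD (KM _ _ Ku) => //.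
by apply: sK => /=; rewrite mulrBr eq_y mulrA addrC addKr.
Qed.

Lemma jacobsonMl x r : jacobson x -> jacobson (r * x).
Proof.
move=> Jx M mM; have [Mr|nMr] := pselect (M r).
  by case: (mM) => -[_ _ MM] _ _; apply: MM.
exact: (Jx _ (maximal_right_ideal_colon mM nMr)).
Qed.

End Ideals.

Section JacobsonQuotient.
Variable R : pzRingType.

Let J : set R := @jacobson R.
Let iJ : right_ideal J := right_ideal_jacobson R.

Definition jacobson_eqmod (x y : R) : bool := `[< J (x - y) >].

Fact jacobson_eqmod_equiv : equiv_class_of jacobson_eqmod.
Proof.
split=> [x|x y|y x z].
- by apply/asboolP; rewrite subrr; case: iJ.
- by apply/asboolP/asboolP=> Jd; rewrite -opprB; apply: (right_idealN iJ).
move=> /asboolP Jxy /asboolP Jyz; apply/asboolP.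
by rewrite -(subrKA y); apply: (right_idealD iJ).
Qed.

Canonical jacobson_eqmod_equiv_rel := EquivRelPack jacobson_eqmod_equiv.

Definition jacobson_quot : Type := {eq_quot jacobson_eqmod}.

HB.instance Definition _ := Choice.on jacobson_quot.
HB.instance Definition _ := Quotient.on jacobson_quot.
HB.instance Definition _ := EqQuotient.on jacobson_quot.

Lemma jacobson_quotP x y :
  reflect (J (x - y)) (\pi_jacobson_quot x == \pi_jacobson_quot y).
Proof. by rewrite eqquotE; exact: asboolP. Qed.

Let pi := \pi_jacobson_quot.
Let eqq x y : J (x - y) -> pi x = pi y.
Proof. by move=> Jxy; apply/eqP/jacobson_quotP. Qed.
Let Jrepr x : J (x - repr (pi x)).
Proof. by apply/jacobson_quotP; rewrite reprK. Qed.

Definition jq_add (x y : jacobson_quot) := pi (repr x + repr y).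
Definition jq_opp (x : jacobson_quot) := pi (- repr x).
Definition jq_mul (x y : jacobson_quot) := pi (repr x * repr y).

Let addE x y : jq_add (pi x) (pi y) = pi (x + y).
Proof.
apply/esym/eqq; rewrite opprD addrACA.
by apply: (right_idealD iJ).
Qed.

Let oppE x : jq_opp (pi x) = pi (- x).
Proof. by apply: eqq; rewrite opprK addrC. Qed.

Let mulE x y : jq_mul (pi x) (pi y) = pi (x * y).
Proof.
apply/esym/eqq; rewrite -(subrKA (x * repr (pi y))) -mulrBr -mulrBl.
apply: (right_idealD iJ); first exact: (jacobsonMl _ (Jrepr y)).
by case: iJ => _ _; apply; exact: Jrepr.
Qed.

#[local] Opaque jq_add jq_opp jq_mul.

Let quotW (P : jacobson_quot -> Prop) : (forall x, P (pi x)) -> forall x, P x.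
Proof. exact: quotW. Qed.

Fact jq_addA : associative jq_add.
Proof. by elim/quotW=> x; elim/quotW=> y; elim/quotW=> z; rewrite !addE addrA. Qed.
Fact jq_addC : commutative jq_add.
Proof. by elim/quotW=> x; elim/quotW=> y; rewrite !addE addrC. Qed.
Fact jq_add0 : left_id (pi 0) jq_add.
Proof. by elim/quotW=> x; rewrite addE add0r. Qed.
Fact jq_addN : left_inverse (pi 0) jq_opp jq_add.
Proof. by elim/quotW=> x; rewrite oppE addE addNr. Qed.
Fact jq_mulA : associative jq_mul.
Proof. by elim/quotW=> x; elim/quotW=> y; elim/quotW=> z; rewrite !mulE mulrA. Qed.
Fact jq_mul1l : left_id (pi 1) jq_mul.
Proof. by elim/quotW=> x; rewrite mulE mul1r. Qed.
Fact jq_mul1r : right_id (pi 1) jq_mul.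
Proof. by elim/quotW=> x; rewrite mulE mulr1. Qed.
Fact jq_mulDl : left_distributive jq_mul jq_add.
Proof.
by elim/quotW=> x; elim/quotW=> y; elim/quotW=> z; rewrite !(mulE, addE) mulrDl.
Qed.
Fact jq_mulDr : right_distributive jq_mul jq_add.
Proof.
by elim/quotW=> x; elim/quotW=> y; elim/quotW=> z; rewrite !(mulE, addE) mulrDr.
Qed.

HB.instance Definition _ := GRing.isPzRing.Build jacobson_quot
  jq_addA jq_addC jq_add0 jq_addN jq_mulA jq_mul1l jq_mul1r jq_mulDl jq_mulDr.

Lemma jacobson_quot_piD : {morph \pi_jacobson_quot : x y / x + y}.
Proof. by move=> x y; exact/esym/addE. Qed.
Lemma jacobson_quot_piM : {morph \pi_jacobson_quot : x y / x * y}.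
Proof. by move=> x y; exact/esym/mulE. Qed.
Lemma jacobson_quot_pi1 : \pi_jacobson_quot 1 = 1.
Proof. by []. Qed.

End JacobsonQuotient.

Definition right_perfect (R : pzRingType) : Prop :=
  semisimple (jacobson_quot R) /\
  forall a : nat -> R, (forall i, (1 <= i)%N -> jacobson (a i)) ->
    exists2 l : nat, (1 <= l)%N & \prod_(1 <= i < l.+1) a i = 0.

(* [\prod_(i <- rev (index_iota 1 l.+1)) a i] is a_l * ... * a_2 * a_1. *)
Definition left_perfect (R : pzRingType) : Prop :=
  semisimple (jacobson_quot R) /\
  forall a : nat -> R, (forall i, (1 <= i)%N -> jacobson (a i)) ->
    exists2 l : nat, (1 <= l)%N & \prod_(i <- rev (index_iota 1 l.+1)) a i = 0.

Section Tensor.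
Variables (k : comPzRingType) (A B : pzAlgType k).
Implicit Types (s t u : seq (A * B)).

(* [:: (a1, b1); ...; (an, bn)] stands for the formal sum of the ai (x) bi.
   Negatives need not be adjoined: (a, b) + (- a, b) is congruent to the empty
   sum, so the quotient is the free abelian group on A * B modulo
   biadditivity and k-balancedness. *)
Inductive tensor_cong : seq (A * B) -> seq (A * B) -> Prop :=
| tensor_refl s : tensor_cong s s
| tensor_sym s t : tensor_cong s t -> tensor_cong t s
| tensor_trans s t u : tensor_cong s t -> tensor_cong t u -> tensor_cong s u
| tensor_cat s s' t t' :
    tensor_cong s s' -> tensor_cong t t' -> tensor_cong (s ++ t) (s' ++ t')
| tensor_catC s t : tensor_cong (s ++ t) (t ++ s)
| tensor_gen0 b : tensor_cong [:: (0, b)] [::]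
| tensor_genDl a a' b : tensor_cong [:: (a + a', b)] [:: (a, b); (a', b)]
| tensor_genDr a b b' : tensor_cong [:: (a, b + b')] [:: (a, b); (a, b')]
| tensor_genZ (c : k) a b :
    tensor_cong [:: (kmap c * a, b)] [:: (a, kmap c * b)].

Definition tensor_eq s t : bool := `[< tensor_cong s t >].

Fact tensor_eq_equiv : equiv_class_of tensor_eq.
Proof.
split=> [s|s t|t s u].
- exact/asboolP/tensor_refl.
- by apply/asboolP/asboolP; apply: tensor_sym.
by move=> /asboolP st /asboolP tu; apply/asboolP/(tensor_trans st).
Qed.

Canonical tensor_eq_equiv_rel := EquivRelPack tensor_eq_equiv.

Definition tensor : Type := {eq_quot tensor_eq}.

HB.instance Definition _ := Choice.on tensor.
HB.instance Definition _ := Quotient.on tensor.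
HB.instance Definition _ := EqQuotient.on tensor.

Lemma tensorP s t : reflect (tensor_cong s t) (\pi_tensor s == \pi_tensor t).
Proof. by rewrite eqquotE; exact: asboolP. Qed.

Let pi := \pi_tensor.
Let eqt s t : tensor_cong s t -> pi s = pi t.
Proof. by move=> st; apply/eqP/tensorP. Qed.
Let Trepr s : tensor_cong s (repr (pi s)).
Proof. by apply/tensorP; rewrite reprK. Qed.

Definition tensor_neg s : seq (A * B) := [seq (- x.1, x.2) | x <- s].
Definition tensor_prd s t : seq (A * B) :=
  [seq (x.1 * y.1, x.2 * y.2) | x <- s, y <- t].

Let cong_map (f : A -> A) (g : B -> B) s t :
    {morph f : x y / x + y} -> {morph g : x y / x + y} ->
    (forall c : k, {morph f : x / kmap c * x}) ->
    (forall c : k, {morph g : x / kmap c * x}) ->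
  tensor_cong s t ->
  tensor_cong [seq (f x.1, g x.2) | x <- s] [seq (f x.1, g x.2) | x <- t].
Proof.
move=> fD gD fZ gZ; elim=> {s t} /=
  [s|s t _|s t u _ st _|s s' t t' _ ss _ tt|s t|b|a a' b|a b b'|c a b].
- exact: tensor_refl.
- exact: tensor_sym.
- exact: tensor_trans.
- by rewrite !map_cat; apply: tensor_cat.
- by rewrite !map_cat; apply: tensor_catC.
- have -> : f 0 = 0 by apply: (addrI (f 0)); rewrite -fD !addr0.
  exact: tensor_gen0.
- by rewrite fD; apply: tensor_genDl.
- by rewrite gD; apply: tensor_genDr.
by rewrite fZ gZ; apply: tensor_genZ.
Qed.

Let cong_neg s t : tensor_cong s t -> tensor_cong (tensor_neg s) (tensor_neg t).
Proof. by apply: (cong_map (g := id)) => //= [x y|c x]; rewrite ?opprD ?mulrN. Qed.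

Let cong_prd s s' t t' : tensor_cong s s' -> tensor_cong t t' ->
  tensor_cong (tensor_prd s t) (tensor_prd s' t').
Proof.
move=> ss tt; apply: (@tensor_trans _ (tensor_prd s t')).
  elim: s {ss} => [|x s IHs]; first exact: tensor_refl.
  rewrite /tensor_prd /=; apply: tensor_cat => //.
  apply: (cong_map (f := fun a => x.1 * a) (g := fun b => x.2 * b)) tt
    => [a b|a b|c a|c a]; by rewrite ?mulrDr // !mulrA kmap_comm.
have swap v : tensor_cong (tensor_prd v t')
    (flatten [seq [seq (x.1 * y.1, x.2 * y.2) | x <- v] | y <- t']).
  elim: v => [|x v IHv].
    by rewrite /tensor_prd /=; elim: (t') => [|y w IHw] /=; [apply: tensor_refl|].
  apply: (tensor_trans (tensor_cat (tensor_refl _) IHv)).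
  elim: (t') => [|y w IHw] /=; first exact: tensor_refl.
  apply: (@tensor_cat [:: _] [:: _]); first exact: tensor_refl.
  rewrite catA; apply: tensor_trans (tensor_cat (tensor_refl _) IHw).
  by rewrite catA; apply: tensor_cat (tensor_refl _); apply: tensor_catC.
apply: (tensor_trans (swap s)); apply: (tensor_trans _ (tensor_sym (swap s'))).
elim: (t') => [|y w IHw] /=; first exact: tensor_refl.
apply: tensor_cat => //.
apply: (cong_map (f := fun a => a * y.1) (g := fun b => b * y.2)) ss
  => [a b|a b|c a|c a]; by rewrite ?mulrDl ?mulrA.
Qed.

Definition tensor_add (x y : tensor) : tensor := pi (repr x ++ repr y).
Definition tensor_opp (x : tensor) : tensor := pi (tensor_neg (repr x)).
Definition tensor_mul (x y : tensor) : tensor := pi (tensor_prd (repr x) (repr y)).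

Let addE s t : tensor_add (pi s) (pi t) = pi (s ++ t).
Proof. by apply/esym/eqt/tensor_cat. Qed.
Let oppE s : tensor_opp (pi s) = pi (tensor_neg s).
Proof. exact/esym/eqt/cong_neg. Qed.
Let mulE s t : tensor_mul (pi s) (pi t) = pi (tensor_prd s t).
Proof. by apply/esym/eqt/cong_prd. Qed.

#[local] Opaque tensor_add tensor_opp tensor_mul.

Let quotW (P : tensor -> Prop) : (forall s, P (pi s)) -> forall x, P x.
Proof. exact: quotW. Qed.

Fact tensor_addA : associative tensor_add.
Proof. by elim/quotW=> x; elim/quotW=> y; elim/quotW=> z; rewrite !addE catA. Qed.
Fact tensor_addC : commutative tensor_add.
Proof.
by elim/quotW=> x; elim/quotW=> y; rewrite !addE; apply/eqt/tensor_catC.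
Qed.
Fact tensor_add0 : left_id (pi [::]) tensor_add.
Proof. by elim/quotW=> x; rewrite addE. Qed.
Fact tensor_addN : left_inverse (pi [::]) tensor_opp tensor_add.
Proof.
elim/quotW=> s; rewrite oppE addE; apply: eqt.
elim: s => [|[a b] s IHs] /=; first exact: tensor_refl.
rewrite -/(tensor_neg s).
apply: (@tensor_trans _ ([:: (- a, b)] ++ [:: (a, b)] ++ tensor_neg s ++ s)).
  apply: (@tensor_cat [:: _] [:: _]); first exact: tensor_refl.
  rewrite -[(a, b) :: s]cat1s 2!catA.
  by apply: tensor_cat (tensor_catC _ _) (tensor_refl _).
rewrite -[X in tensor_cong X]/([:: (- a, b); (a, b)] ++ (tensor_neg s ++ s)).
apply: (@tensor_trans _ ([:: (- a + a, b)] ++ [::])).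
  by apply: tensor_cat => //; apply/tensor_sym/tensor_genDl.
by rewrite addNr; apply: tensor_gen0.
Qed.

HB.instance Definition _ := GRing.isZmodule.Build tensor
  tensor_addA tensor_addC tensor_add0 tensor_addN.

Definition tensor_pure (a : A) (b : B) : tensor := pi [:: (a, b)].

Let pi0 : pi [::] = 0. Proof. by []. Qed.
Let piD s t : pi (s ++ t) = pi s + pi t.
Proof. exact/esym/addE. Qed.
Let piE s : pi s = \sum_(x <- s) tensor_pure x.1 x.2.
Proof.
elim: s => [|[a b] s IHs]; first by rewrite big_nil.
by rewrite big_cons -cat1s piD IHs.
Qed.

Lemma tensor_pureDl b : {morph tensor_pure^~ b : a a' / a + a'}.
Proof. by move=> a a'; rewrite /tensor_pure -piD; apply/eqt/tensor_genDl. Qed.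
Lemma tensor_pureDr a : {morph tensor_pure a : b b' / b + b'}.
Proof. by move=> b b'; rewrite /tensor_pure -piD; apply/eqt/tensor_genDr. Qed.
Lemma tensor_pureZ (c : k) a b : 
  tensor_pure (kmap c * a) b = tensor_pure a (kmap c * b).
Proof. exact/eqt/tensor_genZ. Qed.

Lemma tensor_sum (x : tensor) :
  exists s : seq (A * B), x = \sum_(y <- s) tensor_pure y.1 y.2.
Proof. by elim/quotW: x => s; exists s; apply: piE. Qed.

Fact tensor_mulA : associative tensor_mul.
Proof.
elim/quotW=> s; elim/quotW=> t; elim/quotW=> u; rewrite !mulE; congr pi.
rewrite /tensor_prd; elim: s => //= x s ->; rewrite allpairs_cat; congr (_ ++ _).
elim: t => //= y t IHt; rewrite map_cat IHt; congr (_ ++ _).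
by rewrite -map_comp; apply: eq_map => z /=; rewrite !mulrA.
Qed.
Fact tensor_mul1l : left_id (pi [:: (1, 1)]) tensor_mul.
Proof.
elim/quotW=> s; rewrite mulE /tensor_prd /= cats0; congr pi.
by rewrite -[RHS]map_id; apply: eq_map => -[a b] /=; rewrite !mul1r.
Qed.
Fact tensor_mul1r : right_id (pi [:: (1, 1)]) tensor_mul.
Proof.
elim/quotW=> s; rewrite mulE /tensor_prd; congr pi.
by elim: s => //= -[a b] s -> /=; rewrite !mulr1.
Qed.
Fact tensor_mulDl : left_distributive tensor_mul +%R.
Proof.
elim/quotW=> s; elim/quotW=> t; elim/quotW=> u.
by rewrite -piD !mulE -piD /tensor_prd allpairs_cat.
Qed.
Fact tensor_mulDr : right_distributive tensor_mul +%R.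
Proof.
elim/quotW=> s; elim/quotW=> t; elim/quotW=> u.
rewrite -piD !mulE !piE -big_cat; apply: perm_big.
rewrite /tensor_prd /=.
have -> := perm_allpairs_catr (fun x y : A * B => (x.1 * y.1, x.2 * y.2)) s
             (fun=> t) (fun=> u).
exact: perm_refl.
Qed.

HB.instance Definition _ := GRing.Zmodule_isPzRing.Build tensor
  tensor_mulA tensor_mul1l tensor_mul1r tensor_mulDl tensor_mulDr.

Lemma tensor_pureM a a' b b' :
  tensor_pure a b * tensor_pure a' b' = tensor_pure (a * a') (b * b').
Proof. exact: mulE. Qed.
Lemma tensor_pure1 : tensor_pure 1 1 = 1.
Proof. by []. Qed.

Definition tensor_kmap (c : k) : tensor := tensor_pure (kmap c) 1.

Fact tensor_kmap_is_zmod_morphism : zmod_morphism tensor_kmap.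
Proof.
move=> c d; apply: (addIr (tensor_kmap d)); rewrite subrK.
by rewrite /tensor_kmap -tensor_pureDl -rmorphD subrK.
Qed.
Fact tensor_kmap_is_monoid_morphism : monoid_morphism tensor_kmap.
Proof.
split=> [|c d]; first by rewrite /tensor_kmap rmorph1 tensor_pure1.
by rewrite /tensor_kmap tensor_pureM mulr1 rmorphM.
Qed.
HB.instance Definition _ := GRing.isZmodMorphism.Build k tensor tensor_kmap
  tensor_kmap_is_zmod_morphism.
HB.instance Definition _ := GRing.isMonoidMorphism.Build k tensor tensor_kmap
  tensor_kmap_is_monoid_morphism.

Fact tensor_kmap_comm c (x : tensor) : tensor_kmap c * x = x * tensor_kmap c.
Proof.
have [s ->] := tensor_sum x; rewrite mulr_suml mulr_sumr.
apply: eq_bigr => u _; rewrite /tensor_kmap !tensor_pureM.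
by rewrite mulr1 mul1r kmap_comm.
Qed.

HB.instance Definition _ := @PzRing_isPzAlgebra.Build k tensor
  (tensor_kmap : {rmorphism k -> tensor}) tensor_kmap_comm.

Lemma tensor_universal (M : zmodType) (f : A -> B -> M) :
    (forall b, {morph f^~ b : a a' / a + a'}) ->
    (forall a, {morph f a : b b' / b + b'}) ->
    (forall (c : k) a b, f (kmap c * a) b = f a (kmap c * b)) ->
  exists2 g : tensor -> M, {morph g : x y / x + y}
    & (forall a b, g (tensor_pure a b) = f a b).
Proof.
move=> fDl fDr fZ; pose F s := \sum_(x <- s) f x.1 x.2.
have Fcong s t : tensor_cong s t -> F s = F t.
  rewrite /F; elim=> {s t} //
    [s t u _ -> _ -> //|s s' t t' _ ss _ tt|s t|b|a a' b|a b b'|c a b].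
  - by rewrite !big_cat ss tt.
  - by rewrite !big_cat /= addrC.
  - rewrite big_seq1 big_nil /=; apply: (addrI (f 0 b)).
    by rewrite -fDl !addr0.
  - by rewrite big_seq1 big_cons big_seq1 /= fDl.
  - by rewrite big_seq1 big_cons big_seq1 /= fDr.
  by rewrite !big_seq1 /= fZ.
have Fpi s : F (repr (pi s)) = F s by apply/esym/Fcong.
exists (fun x => F (repr x)) => [|a b].
  by elim/quotW=> s; elim/quotW=> t; rewrite -piD !Fpi /F big_cat.
by rewrite Fpi /F big_seq1.
Qed.

End Tensor.

(* Main.v *)
(* A perfect periodic ring R is locally finite: finite subsets generate finite
   subrings.  Indeed R has positive characteristic; J(R) is locally finite
   because, by a Koenig-type argument, T-nilpotence kills all long words in
   finitely many elements; R/J(R) is glued from corners eRe that are torsion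
   division rings, hence locally finite fields by Jacobson and Wedderburn; and
   local finiteness is inherited by extensions.  An element of A (x) B then lies
   in a subring spanned by pure tensors over finite subrings of A and B, so its
   powers repeat. *)
Require Import Defs.
From HB Require Import structures.
From mathcomp Require Import all_boot all_order all_algebra all_field.
From mathcomp Require Import boolp classical_sets cardinality.

Set Implicit Arguments.
Unset Strict Implicit.
Unset Printing Implicit Defensive.

Import GRing.Theory.

Local Open Scope ring_scope.
Local Open Scope quotient_scope.
Local Open Scope classical_set_scope.

(** * Additive subgroups generated by a set *)

Section AdditiveClosure.
Variable V : zmodType.
Implicit Types X Y C : set V.

Definition add_closed C : Prop :=
  C 0 /\ forall x y, C x -> C y -> C (x - y).

Inductive addgen X : set V :=
| addgen_in x : X x -> addgen X x
| addgen0 : addgen X 0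
| addgenB x y : addgen X x -> addgen X y -> addgen X (x - y).

Lemma addgen_closed X : add_closed (addgen X).
Proof. by split; [exact: addgen0 | exact: addgenB]. Qed.

Lemma addgen_sub X C : add_closed C -> X `<=` C -> addgen X `<=` C.
Proof. by move=> [C0 CB] sXC x; elim=> [y /sXC||y z _ Cy _] //; exact: CB. Qed.

Lemma add_closedN C x : add_closed C -> C x -> C (- x).
Proof. by move=> [C0 CB] Cx; rewrite -sub0r; apply: CB. Qed.

Lemma add_closedD C x y : add_closed C -> C x -> C y -> C (x + y).
Proof.
by move=> clC Cx Cy; rewrite -[y]opprK; apply: clC.2 => //; apply: add_closedN.
Qed.

Lemma add_closed_sum C I (s : seq I) (P : pred I) (F : I -> V) :
  add_closed C -> (forall i, P i -> C (F i)) -> C (\sum_(i <- s | P i) F i).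
Proof.
move=> clC CF; elim/big_ind: _ => //; first exact: clC.1.
by move=> x y; apply: add_closedD.
Qed.

(** Since N kills V, a generator x contributes only the N multiples [x *+ c] with c < N, so finitely
    many generators yield finitely many sums. *)
Lemma finite_addgen N X : (0 < N)%N -> (forall x : V, x *+ N = 0) ->
  finite_set X -> finite_set (addgen X).
Proof.
move=> N_gt0 VN /finite_seqP[s ->{X}]; elim: s => [|x s IHs].
  apply: sub_finite_set (finite_set1 (0 : V)); apply: addgen_sub => //.
  by split=> //= y z -> ->; rewrite subrr.
apply: sub_finite_set
  (finite_image2 (fun c u => x *+ c + u) (finite_II N) IHs).
apply: addgen_sub.
  split=> [|_ _ [c cN [u su <-]] [d dN [v sv <-]]].
    by exists 0%N => //; exists 0; [exact: addgen0 | rewrite mulr0n addr0].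
  exists ((c + (N - d)) %% N)%N; first exact: ltn_pmod.
  exists (u - v); first exact: addgenB.
  rewrite opprD addrACA; congr (_ + _); apply/esym.
  have -> n : x *+ (n %% N) = x *+ n.
    by rewrite [in RHS](divn_eq n N) mulrnDr mulrnA VN add0r.
  by rewrite mulrnDr mulrnBr ?VN ?sub0r // ltnW.
move=> y /=; rewrite inE => /orP[/eqP->|sy].
  (* For N = 1 the coefficient 1 is out of range, but then every element is 0 and the coefficient 0
     serves. *)
  case: N N_gt0 VN {IHs} => // -[|N] _ VN.
    exists 0%N => //; exists 0; first exact: addgen0.
    by rewrite addr0 mulr0n -[LHS](VN x).
  by exists 1%N => //; exists 0; [exact: addgen0 | rewrite addr0].
exists 0%N => //; exists y; first exact: addgen_in.
by rewrite mulr0n add0r.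
Qed.

End AdditiveClosure.

(** * Subrings without identity, and local finiteness *)

Section RingClosure.
Variable R : pzRingType.
Implicit Types X Y Z C G : set R.

(* Closed under products but without identity, so that it makes sense inside
   ideals and corners. *)
Inductive rnggen X : set R :=
| rnggen_in x : X x -> rnggen X x
| rnggen0 : rnggen X 0
| rnggenB x y : rnggen X x -> rnggen X y -> rnggen X (x - y)
| rnggenM x y : rnggen X x -> rnggen X y -> rnggen X (x * y).

Definition locally_finite C : Prop :=
  forall X, X `<=` C -> finite_set X -> finite_set (rnggen X).

Lemma rnggen_closed X : add_closed (rnggen X).
Proof. by split; [exact: rnggen0 | exact: rnggenB]. Qed.

Lemma rnggen_sub X C : add_closed C -> (forall x y, C x -> C y -> C (x * y)) ->
  X `<=` C -> rnggen X `<=` C.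
Proof.
move=> [C0 CB] CM sXC x.
by elim=> [y /sXC||y z _ Cy _|y z _ Cy _] //; [exact: CB | exact: CM].
Qed.

Lemma rnggen_mono X Y : X `<=` Y -> rnggen X `<=` rnggen Y.
Proof.
move=> sXY; apply: rnggen_sub (rnggen_closed _) _ _ => [x y|x /sXY].
  exact: rnggenM.
exact: rnggen_in.
Qed.

(* Only words, read as iterated left multiplications by generators, matter. *)
Lemma rnggen_sub_left X C : add_closed C -> X `<=` C ->
  (forall x c, X x -> C c -> C (x * c)) -> rnggen X `<=` C.
Proof.
move=> clC sXC XC.
suff sub : rnggen X `<=` [set g | C g /\ forall c, C c -> C (g * c)].
  by move=> g /sub[].
apply: rnggen_sub => [|x y [Cx Lx] [Cy Ly]|x Xx].
- split=> [|x y [Cx Lx] [Cy Ly]]; first split=> [|c _].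
  + exact: clC.1.
  + by rewrite mul0r; exact: clC.1.
  split=> [|c Cc]; first exact: clC.2.
  by rewrite mulrBl; apply: clC.2; [exact: Lx | exact: Ly].
- by split=> [|c Cc]; [exact: Lx | rewrite -mulrA; apply/Lx/Ly].
by split=> [|c]; [exact: sXC | exact: XC].
Qed.

Lemma rnggen_addgen X : (forall x y, X x -> X y -> X (x * y)) ->
  rnggen X `<=` addgen X.
Proof.
move=> XM; apply: rnggen_sub_left => [|x|x c Xx]; first exact: addgen_closed.
  exact: addgen_in.
apply: (addgen_sub (C := [set c | addgen X (x * c)])) => [|y Xy].
  split=> [|y z] /=; first by rewrite mulr0; exact: addgen0.
  by rewrite mulrBr; exact: addgenB.
by apply/addgen_in/XM.
Qed.

Lemma rnggen_rnggen X Y : X `<=` rnggen Y -> rnggen X `<=` rnggen Y.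
Proof. by apply: rnggen_sub (rnggen_closed _) _ => x y; exact: rnggenM. Qed.

Lemma finite_rnggen_mulclosed N X : (0 < N)%N -> (forall x : R, x *+ N = 0) ->
  (forall x y, X x -> X y -> X (x * y)) ->
  finite_set X -> finite_set (rnggen X).
Proof.
move=> N_gt0 RN XM finX; apply: sub_finite_set (rnggen_addgen XM) _.
exact: finite_addgen N_gt0 RN finX.
Qed.

Lemma finite_rnggen_sub X Y : X `<=` rnggen Y -> finite_set (rnggen Y) ->
  finite_set (rnggen X).
Proof. by move=> /rnggen_rnggen; exact: sub_finite_set. Qed.

End RingClosure.

(** Two equal powers of the element 2 give the bound [2 ^ n - 2 ^ m]. *)
Lemma periodic_mulrn (R : pzRingType) : periodic R ->
  exists2 N, (0 < N)%N & forall x : R, x *+ N = 0.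
Proof.
move=> /(_ 2%:R)[m [n [_ _ mn]]]; wlog ltmn : m n mn / (m < n)%N.
  move=> wl; case: (ltngtP m n) => // [lt|gt /esym]; first exact: wl lt.
  by apply: wl gt => /esym.
move=> e; exists (2 ^ n - 2 ^ m)%N; first by rewrite subn_gt0 ltn_exp2l.
move=> x; rewrite -mulr_natl natrB ?leq_exp2l ?(ltnW ltmn) //.
by rewrite !natrX e subrr mul0r.
Qed.

Lemma finite_rnggen_periodic (R : pzRingType) (x : R) :
  finite_set (rnggen [set x]) ->
  exists m n : nat, [/\ (0 < m)%N, (0 < n)%N, m <> n & x ^+ m = x ^+ n].
Proof.
move=> fin; apply: contrapT => nper; apply: infinite_nat.
(* Exponents start at 1 because [rnggen [set x]] need not contain the identity. *)
pose f n := x ^+ n.+1.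
have inj : {in [set: nat] &, injective f}.
  move=> m n _ _ e; apply: contrapT => mn; apply: nper.
  by exists m.+1, n.+1; split=> // -[].
have rng : range f `<=` rnggen [set x].
  move=> _ [n _ <-]; rewrite /f; elim: n => [|n IHn].
    by rewrite expr1; exact: rnggen_in.
  by rewrite exprS; apply: rnggenM => //; exact: rnggen_in.
rewrite -(eq_finite_set (inj_card_eq inj)).
exact: sub_finite_set fin.
Qed.

(** * Local finiteness of T-nilpotent sets *)

Section TNilpotent.
Variables (R : pzRingType) (N : nat).
Hypotheses (N_gt0 : (0 < N)%N) (RN : forall x : R, x *+ N = 0).

(* If w * rnggen X is infinite then so is w * x * rnggen X for some x in X;
   iterating contradicts T-nilpotence. *)
Lemma T_nilpotent_locally_finite (I : set R) :
    (forall a : nat -> R, (forall i, I (a i)) ->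
      exists l, \prod_(0 <= i < l) a i = 0) ->
  locally_finite I.
Proof.
move=> Tnil X sXI finX; apply: contrapT => infX.
pose bad w := ~ finite_set [set w * g | g in rnggen X].
have step w : exists x, bad w -> X x /\ bad (w * x).
  have [bw|] := pselect (bad w); last by exists 0.
  apply: contrapT => /forallNP nx; apply: bw.
  (* Elements of [w * rnggen X] are sums of words beginning with some [w * x]. If no [w * x] were
     bad, the finite set U would generate them all additively. *)
  pose U := [set w * x | x in X] `|`
    \bigcup_(x in X) [set w * x * g | g in rnggen X].
  have finU : finite_set U.
    rewrite finite_setU; split; first exact: finite_image.
    apply: bigcup_finite => // x Xx; apply: contrapT => bx.
    by case: (nx x) => _; split.
  apply: sub_finite_set (finite_addgen N_gt0 RN finU) => _ [g Xg <-].
  suff: rnggen X `<=` [set g | rnggen X g /\ addgen U (w * g)].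
    by move=> /(_ _ Xg)[].
  apply: rnggen_sub_left => [|x Xx|x c Xx [Xc _]].
  - split=> [|x y [Xx Ux] [Xy Uy]] /=.
      by rewrite mulr0; split; [exact: rnggen0 | exact: addgen0].
    by rewrite mulrBr; split; [exact: rnggenB | exact: addgenB].
  - split; first exact: rnggen_in.
    by apply: addgen_in; left; exists x.
  split; first by apply: rnggenM => //; exact: rnggen_in.
  by apply: addgen_in; right; exists x => //; exists c; rewrite ?mulrA.
have [x0 Xx0] : X !=set0.
  apply/set0P/eqP => X0; apply: infX; rewrite X0.
  apply: sub_finite_set (finite_set1 (0 : R)).
  apply: rnggen_sub => // [|x y -> _]; last by rewrite mul0r.
  by split=> //= x y -> ->; rewrite subrr.
have [nx nxP] := choice step.
(* [w n] is the product of the first n chosen letters; it stays bad, hence nonzero. *)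
pose w := fix w n := if n is m.+1 then w m * nx (w m) else 1.
have badw n : bad (w n).
  elim: n => [|n IHn] /=; last by have [] := nxP _ IHn.
  rewrite /bad; suff -> : [set 1 * g | g in rnggen X] = rnggen X by [].
  by under eq_fun do rewrite mul1r; rewrite image_id.
have [i|l] := Tnil (fun n => nx (w n)).
  by apply: sXI; have [] := nxP _ (badw i).
have -> : \prod_(0 <= i < l) nx (w i) = w l.
  elim: l => [|l IHl]; first by rewrite big_geq.
  by rewrite big_nat_recr //= IHl.
move=> wl0; apply: (badw l); rewrite wl0.
apply: sub_finite_set (finite_set1 (0 : R)) => _ [g _ <-].
by rewrite mul0r.
Qed.

End TNilpotent.

(** * Lifting local finiteness from R/J(R) to R *)

Section Extension.
Variables (R : pzRingType) (N : nat).
Hypotheses (N_gt0 : (0 < N)%N) (RN : forall x : R, x *+ N = 0).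

Let pi : R -> jacobson_quot R := \pi_(jacobson_quot R).

(** Modulo J, the products of elements of X have finitely many representatives, collected in V; the
    errors made by choosing representatives generate a finite subring T of J. The additive group
    generated by V and T is then finite and stable under left multiplication by X. *)
Lemma locally_finite_extension :
  locally_finite (@jacobson R) -> locally_finite [set: jacobson_quot R] ->
  locally_finite [set: R].
Proof.
move=> finJ finQ X _ finX.
pose r x := repr (pi x).
have Jr x : jacobson (x - r x) by apply/jacobson_quotP; rewrite reprK.
pose S := rnggen (pi @` X).
have finS : finite_set S by apply: finQ => //; exact: finite_image.
pose V := X `|` repr @` S.
have finV : finite_set V by rewrite finite_setU; split=> //; exact: finite_image.
have piV v : V v -> S (pi v).
  by case=> [Xv|[s Ss <-]]; [apply: rnggen_in; exists v | rewrite /pi reprK].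
have VrM u v : V u -> V v -> V (r (u * v)).
  move=> Vu Vv; right; exists (pi (u * v)) => //.
  by rewrite /pi jacobson_quot_piM; apply: rnggenM; exact: piV.
(* The defect of multiplicativity of the section r on the finite set V. *)
pose Z := [set u * v - r (u * v) | u in V & v in V].
have finZ : finite_set Z by exact: finite_image2.
have sZJ : Z `<=` @jacobson R by move=> _ [u _ [v _ <-]].
(* The products [v * z] are included so that V * T stays in T: [v * (u * z)] equals
   [(v * u - r (v * u)) * z + r (v * u) * z], and both terms lie in T. *)
pose W := Z `|` [set v * z | v in V & z in Z].
pose T := rnggen W.
have finT : finite_set T.
  apply: finJ; last by rewrite finite_setU; split=> //; exact: finite_image2.
  by move=> _ [/sZJ //|[v _ [z /sZJ Jz <-]]]; exact: jacobsonMl.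
have ZT z : Z z -> T z by move=> Zz; apply: rnggen_in; left.
have VZT v z : V v -> Z z -> T (v * z).
  by move=> Vv Zz; apply: rnggen_in; right; exists v => //; exists z.
have ZVV u v : V u -> V v -> Z (u * v - r (u * v)).
  by move=> Vu Vv; exists u => //; exists v.
have VT v t : V v -> T t -> T (v * t).
  move=> Vv; elim=> {t} [w [Zw|[u Vu [z Zz <-]]]||x y _ Tx _ Ty|x y _ Tx Ty _].
  - exact: VZT.
  - rewrite mulrA -[v * u](subrK (r (v * u))) mulrDl.
    apply: add_closedD (rnggen_closed _) _ _; last by apply: VZT => //; exact: VrM.
    by apply: rnggenM; apply: ZT => //; exact: ZVV.
  - by rewrite mulr0; exact: rnggen0.
  - by rewrite mulrBr; exact: rnggenB.
  - by rewrite mulrA; exact: rnggenM.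
have finC : finite_set (addgen (V `|` T)).
  by apply: finite_addgen RN _ => //; rewrite finite_setU.
apply: sub_finite_set finC; apply: rnggen_sub_left => [|x Xx|x c Xx].
- exact: addgen_closed.
- by apply: addgen_in; left; left.
have Vx : V x by left.
apply: (addgen_sub (C := [set c | addgen (V `|` T) (x * c)])) => [|y].
  split=> [|y z] /=; first by rewrite mulr0; exact: addgen0.
  by rewrite mulrBr; exact: addgenB.
case=> [Vy|Ty] /=; last by apply: addgen_in; right; exact: VT.
rewrite -[x * y](subrK (r (x * y))); apply: add_closedD (addgen_closed _) _ _.
  by apply: addgen_in; right; apply: ZT; exact: ZVV.
by apply: addgen_in; left; exact: VrM.
Qed.

End Extension.

(** * Corners and Peirce decomposition *)

Section Corner.
Variable R : pzRingType.
Implicit Types e f x : R.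

(** For idempotent e this is eRe, a ring with identity e. *)
Definition corner e : set R := [set x | e * x = x /\ x * e = x].

Lemma cornerP e x : e * e = e -> corner e (e * x * e).
Proof. by move=> ee; split; rewrite -?mulrA ?ee // !mulrA ee. Qed.

Lemma corner_closed e : add_closed (corner e).
Proof.
split=> [|x y [ex xe] [ey ye]]; first by split; rewrite ?mulr0 ?mul0r.
by split; rewrite ?mulrBr ?mulrBl ?ex ?ey ?xe ?ye.
Qed.

Variable N : nat.
Hypotheses (N_gt0 : (0 < N)%N) (RN : forall x : R, x *+ N = 0).

(** Read a product of Peirce components as a path between two states, [e * x * f] being a step from
    e to f. Cutting paths at their visits to e leaves loops, which generate finite rings inside a
    single corner, and a bounded number of connecting factors from finite sets. *)
Lemma locally_finite_cornerD e f :
    e * e = e -> f * f = f -> e * f = 0 -> f * e = 0 ->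
    locally_finite (corner e) -> locally_finite (corner f) ->
  locally_finite (corner (e + f)).
Proof.
move=> ee ff ef fe fine finf X sX finX.
have finM (Y Y' : set R) : finite_set Y -> finite_set Y' ->
    finite_set [set y * y' | y in Y & y' in Y'] by exact: finite_image2.
pose X' g h := [set g * x * h | x in X].
have finX' g h : finite_set (X' g h) by exact: finite_image.
(* S2 = words in f X f; a loop at e is a letter of e X e or leaves through
   e X f, stays in S2, and returns through f X e. *)
pose S2 := rnggen (X' f f) `|` [set f].
have finS2 : finite_set S2.
  rewrite finite_setU; split; last exact: finite_set1.
  by apply: finf => // _ [x _ <-]; exact: cornerP.
(* Up to sums, paths from f that stop at their first arrival at e. *)
pose P := [set s * b | s in S2 & b in X' f e].
have finP : finite_set P by exact: finM.
pose L := X' e e `|` [set a * p | a in X' e f & p in P].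
pose S1 := rnggen L `|` [set e].
have finS1 : finite_set S1.
  rewrite finite_setU; split; last exact: finite_set1.
  apply: fine; last by rewrite finite_setU; split=> //; exact: finM.
  move=> _ [[x _ <-]|[_ [x _ <-] [_ [s _ [_ [y _ <-] <-]] <-]]].
    exact: cornerP.
  rewrite (_ : _ * _ = e * (x * f * (s * (f * y))) * e); last by rewrite !mulrA.
  exact: cornerP.
have S1e s : S1 s -> e * s = s.
  case=> [|-> //]; elim=> {s} [_ [[x _ <-]|[_ [x _ <-] [p _ <-]]]|||].
  - by rewrite !mulrA ee.
  - by rewrite !mulrA ee.
  - by rewrite mulr0.
  - by move=> x y _ ex _ ey; rewrite mulrBr ex ey.
  - by move=> x y _ ex _ ey; rewrite mulrA ex.
have S2f s : S2 s -> f * s = s.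
  case=> [|-> //]; elim=> {s} [_ [x _ <-]|||].
  - by rewrite !mulrA ff.
  - by rewrite mulr0.
  - by move=> x y _ ex _ ey; rewrite mulrBr ex ey.
  - by move=> x y _ ex _ ey; rewrite mulrA ex.
have LS1 l s : L l -> S1 s -> S1 (l * s).
  move=> Ll Ss; left; case: Ss => [Ls|->].
    by apply: rnggenM => //; exact: rnggen_in.
  rewrite (_ : l * e = l); first exact: rnggen_in.
  by case: Ll => [[x _ <-]|[a _ [_ [s0 _ [_ [x _ <-] <-]] <-]]];
    rewrite -!mulrA ee.
have XS2 a s : X' f f a -> S2 s -> S2 (a * s).
  move=> Xa Ss; left; case: Ss => [Ls|->].
    by apply: rnggenM => //; exact: rnggen_in.
  case: (Xa) => x Xx <-; rewrite -mulrA ff; apply: rnggen_in; by exists x.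
(* What follows the last visit to e: nothing, or a departure to f for good. *)
pose W := [set e] `|` [set a * s | a in X' e f & s in S2].
have finW : finite_set W.
  by rewrite finite_setU; split; [exact: finite_set1 | exact: finM].
pose S1W := [set s * w | s in S1 & w in W].
have finS1W : finite_set S1W by exact: finM.
(* Paths staying at f, paths starting at e, and paths starting at f that visit e. *)
pose H := S2 `|` (S1W `|` [set p * u | p in P & u in S1W]).
have finH : finite_set H.
  rewrite finite_setU; split=> //; rewrite finite_setU; split=> //.
  exact: finM.
pose C := addgen H.
apply: sub_finite_set (finite_addgen N_gt0 RN finH).
have clC : add_closed C := addgen_closed H.
have CS2 s : S2 s -> C s by move=> ?; apply: addgen_in; left.
have CS1W s : S1W s -> C s by move=> ?; apply: addgen_in; right; left.
have CPS1W p u : P p -> S1W u -> C (p * u).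
  by move=> Pp Su; apply: addgen_in; right; right; exists p => //; exists u.
have fS2 : S2 f by right.
have eS1 : S1 e by right.
have eW : W e by left.
have S1We u : S1W u -> e * u = u.
  by case=> s Ss [w _ <-]; rewrite mulrA S1e.
have Pf p : P p -> f * p = p.
  by case=> s Ss [w _ <-]; rewrite mulrA S2f.
have eS1W : S1W e by exists e => //; exists e.
have decX x : X x ->
    x = (e * x * e + e * x * f) + (f * x * e + f * x * f).
  by move=> /sX[ex xe]; rewrite -!mulrDr -!mulrDl ex xe.
have XP x : X x -> P (f * x * e).
  by move=> Xx; exists f => //; exists (f * x * e); [exists x | rewrite !mulrA ff].
apply: rnggen_sub_left => // x.
  move=> Xx; rewrite {}(decX _ Xx); do 2?apply: (add_closedD clC).
  - apply: CS1W; exists (e * x * e); last by exists e => //; rewrite -mulrA ee.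
    by left; apply: rnggen_in; left; exists x.
  - apply: CS1W; exists e => //; exists (e * x * f); last by rewrite !mulrA ee.
    right; exists (e * x * f); first by exists x.
    by exists f => //; rewrite -mulrA ff.
  - rewrite (_ : f * x * e = f * x * e * e); last by rewrite -[RHS]mulrA ee.
    by apply: CPS1W => //; exact: XP.
  - by apply: CS2; left; apply: rnggen_in; exists x.
move=> c Xx; apply: (addgen_sub (C := [set c | C (x * c)])) => {c} [|c Hc].
  split=> [|y z] /=; first by rewrite mulr0; exact: addgen0.
  by rewrite mulrBr; exact: addgenB.
rewrite /= (decX _ Xx) !mulrDl.
have z1 g y : f * y = y -> g * e * y = 0.
  by move=> <-; rewrite -mulrA (mulrA e) ef mul0r mulr0.
have z2 g y : e * y = y -> g * f * y = 0.
  by move=> <-; rewrite -mulrA (mulrA f) fe mul0r mulr0.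
(* Only the two Peirce components of x that end at the state where the path starts survive; each
   extends it to a path of a listed kind. *)
case: Hc => [Sc|[Sc|[p Pp [u Su <-]]]].
- have fc := S2f _ Sc; rewrite !z1 // !add0r.
  apply: (add_closedD clC); last by apply/CS2/XS2 => //; exists x.
  apply: CS1W; exists e => //; exists (e * x * f * c); last by rewrite !mulrA ee.
  by right; exists (e * x * f); [exists x | exists c].
- have ec := S1We _ Sc; rewrite !(z2 _ _ ec) !addr0.
  apply: (add_closedD clC); last by apply: CPS1W => //; exact: XP.
  case: Sc {ec} => s Ss [w Ww <-]; apply: CS1W; exists (e * x * e * s).
    by apply: LS1 => //; left; exists x.
  by exists w => //; rewrite !mulrA.
have fpu : f * (p * u) = p * u by rewrite mulrA Pf.
rewrite !z1 // !add0r; apply: (add_closedD clC); last first.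
  rewrite mulrA; apply: CPS1W => //; case: Pp {fpu} => s Ss [b Xb <-].
  by exists (f * x * f * s); [apply: XS2 => //; exists x | exists b; rewrite ?mulrA].
case: Su {fpu} => s Ss [w Ww <-]; apply: CS1W; exists (e * x * f * p * s).
  apply: LS1 => //; right; exists (e * x * f); first by exists x.
  by exists p.
by exists w => //; rewrite !mulrA.
Qed.

End Corner.

(** * Finite subrings of domains *)

Record finite_subring (D : nzRingType) := FiniteSubring {
  fsr_seq : seq D;
  fsr_closed : subring_closed [pred x in fsr_seq]
}.

Section FiniteSubring.
Variables (D : nzRingType) (S : finite_subring D).

(** [seq_sub] makes the subring a finite type, so that it can carry a finite ring structure. *)
Definition fsr_type : Type := seq_sub (fsr_seq S).

HB.instance Definition _ := SubFinite.on fsr_type.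
HB.instance Definition _ := GRing.SubChoice_isSubNzRing.Build D
  (fun x => x \in fsr_seq S) fsr_type (fsr_closed S).
HB.instance Definition _ := FinRing.isNzRing.Build fsr_type.

(** Wedderburn's little theorem, applied to the subring as a finite domain. *)
Lemma finite_subring_comm :
    (forall x y : D, x * y = 0 -> x = 0 \/ y = 0) ->
  {in fsr_seq S &, forall x y, x * y = y * x}.
Proof.
move=> dom x y Sx Sy.
have domS : GRing.integral_domain_axiom fsr_type.
  move=> u v /(congr1 (val : fsr_type -> D)).
  rewrite rmorphM rmorph0 => /dom[] e0; apply/orP; [left | right].
    by apply/eqP/val_inj; rewrite e0 rmorph0.
  by apply/eqP/val_inj; rewrite e0 rmorph0.
by have /(congr1 val) := finDomain_mulrC domS (SeqSub Sx) (SeqSub Sy).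
Qed.

End FiniteSubring.

(** * Torsion division rings *)

Section TorsionDivisionRing.
Variable D : nzRingType.
Hypothesis torsion : forall x : D, x != 0 -> exists2 n, (0 < n)%N & x ^+ n = 1.
Implicit Types a x y z : D.

Lemma torsion_mulf_eq0 x y : x * y = 0 -> x = 0 \/ y = 0.
Proof.
have [->|/torsion[[|n] // _ xn1] xy0] := eqVneq x 0; first by left.
by right; rewrite -[y]mul1r -xn1 exprSr -mulrA xy0 mulr0.
Qed.

Lemma torsion_order a : a != 0 ->
  exists m, [/\ (0 < m)%N, a ^+ m = 1 & forall j, (0 < j < m)%N -> a ^+ j != 1].
Proof.
move=> /torsion[n n_gt0 an1].
have exm : exists m, (0 < m)%N && (a ^+ m == 1) by exists n; rewrite n_gt0 an1 /=.
case: (ex_minnP exm) => m /andP[m_gt0 /eqP am1] minm; exists m; split=> // j.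
move=> /andP[j_gt0 ltjm]; apply: contraTN ltjm => aj1.
by rewrite -leqNgt minm // j_gt0.
Qed.

(** Split off the least prime divisor p of m: without zero divisors, p or [m %/ p] already vanishes,
    and the second case recurses. *)
Lemma torsion_natf0_prime m : (0 < m)%N -> m%:R = 0 :> D ->
  exists p, [/\ prime p, (p %| m)%N & p%:R = 0 :> D].
Proof.
have [n] := ubnP m; elim: n m => // n IHn m lt_mn m_gt0 m0.
have m_gt1 : (1 < m)%N.
  by case: m m_gt0 m0 {lt_mn} => [|[]] // _ /eqP; rewrite oner_eq0.
have p_pr := pdiv_prime m_gt1; have p_dv := pdiv_dvd m.
have ltq : (m %/ pdiv m < m)%N by rewrite ltn_Pdiv // prime_gt1.
have := m0; rewrite -(divnK p_dv) natrM => /torsion_mulf_eq0[q0|p0]; last first.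
  by exists (pdiv m); rewrite divnK.
have [||//|p [pp pq pp0]] := IHn (m %/ pdiv m)%N.
- by apply: leq_trans ltq _; rewrite -ltnS.
- by rewrite divn_gt0 ?prime_gt0 // dvdn_leq.
by exists p; rewrite divnK //; split=> //; apply: dvdn_trans pq (dvdn_div p_dv).
Qed.

(** If m vanished, D would have characteristic some prime p dividing m. With b = [a ^+ (m %/ p)],
    Frobenius gives (b - 1)^p = b^p - 1 = 0, so b = 1, against the minimality of m. *)
Lemma torsion_order_neq0 a m : (0 < m)%N -> a ^+ m = 1 ->
  (forall j, (0 < j < m)%N -> a ^+ j != 1) -> m%:R != 0 :> D.
Proof.
move=> m_gt0 am1 minm; apply/eqP => /(torsion_natf0_prime m_gt0)[p [p_pr p_dv p0]].
have pcharp : p \in [pchar D] by rewrite inE p_pr p0 /=.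
pose b := a ^+ (m %/ p).
have : b != 1.
  apply: minm; rewrite divn_gt0 ?prime_gt0 // dvdn_leq //=.
  by rewrite ltn_Pdiv // prime_gt1.
have bp0 : (b - 1) ^+ p = 0.
  rewrite -(pFrobenius_autE pcharp) pFrobenius_autB_comm; last exact: commr1.
  by rewrite !pFrobenius_autE -exprM divnK // am1 expr1n subrr.
have expf0 n (y : D) : y ^+ n = 0 -> y = 0.
  elim: n => [/eqP|n IHn]; first by rewrite expr0 oner_eq0.
  by rewrite exprS => /torsion_mulf_eq0[].
by rewrite -subr_eq0 (expf0 _ _ bp0) eqxx.
Qed.

(* Right multiplication by a satisfies X^m = 1, which over the field generated
   by a splits with distinct roots a^i; the z_i below are the components of
   m * z in the eigenspaces { x | x * a = a^i * x }. *)
Lemma torsion_conjugate a z : a != 0 -> z * a <> a * z ->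
  exists x i, [/\ x != 0, x * a = a ^+ i * x & a ^+ i <> a].
Proof.
move=> a0 za; have [m [m_gt0 am1 minm]] := torsion_order a0.
apply: contrapT => nex.
pose b := a ^+ m.-1.
have ab : a * b = 1 by rewrite -exprS prednK.
have cab : GRing.comm a b by exact: commrX.
have bm1 : b ^+ m = 1 by rewrite -exprM mulnC exprM am1 expr1n.
pose z_ i := \sum_(0 <= j < m) (b ^+ i) ^+ j * z * a ^+ j.
have z_a i : z_ i * a = a ^+ i * z_ i.
  pose F j := (b ^+ i) ^+ j * z * a ^+ j.
  have abi : a ^+ i * b ^+ i = 1 by rewrite -exprMn_comm // ab expr1n.
  (* The sum is cyclic: its terms of index 0 and m agree, both powers having period m. *)
  have shift : \sum_(0 <= j < m) F j.+1 = \sum_(0 <= j < m) F j.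
    apply: (addrI (F 0%N)); rewrite -big_nat_recl // big_nat_recr //= addrC.
    by rewrite /F -exprM mulnC exprM bm1 am1 !expr1n !expr0.
  rewrite (_ : z_ i = \sum_(0 <= j < m) F j) // -[in RHS]shift big_distrl big_distrr /=.
  apply: eq_bigr => j _; rewrite /F exprS exprSr !mulrA abi mul1r.
  by rewrite -!mulrA.
have comm_z i : z_ i * a = a * z_ i.
  have [zi0|zi0] := eqVneq (z_ i) 0; first by rewrite zi0 mul0r mulr0.
  rewrite z_a; have [->//|nai] := pselect (a ^+ i = a).
  by case: nex; exists (z_ i), i.
(* After exchanging the sums, the geometric sum of the powers of [b ^+ j] vanishes for 0 < j < m
   because [b ^+ j] differs from 1; only j = 0 contributes. *)
have sumz : \sum_(0 <= i < m) z_ i = m%:R * z.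
  rewrite exchange_big /= big_ltn // [X in _ + X](_ : _ = 0) ?addr0.
    under eq_bigr do rewrite expr0 mul1r mulr1.
    by rewrite sumr_const_nat subn0 mulr_natl.
  rewrite big_nat_cond big1 // => j /[!andbT] j0m; rewrite -!big_distrl /=.
  rewrite [X in X * _](_ : _ = 0) ?mul0r //.
  have : (b ^+ j - 1) * \sum_(0 <= i < m) (b ^+ i) ^+ j = 0.
    rewrite big_mkord; under eq_bigr do rewrite -exprM mulnC exprM.
    by rewrite -subrX1 -exprM mulnC exprM bm1 expr1n subrr.
  case/torsion_mulf_eq0=> [/eqP|->]; rewrite ?mul0r //.
  rewrite subr_eq0 => /eqP bj1; have /eqP[] := minm j j0m.
  by rewrite -[a ^+ j]mulr1 -bj1 -exprMn_comm // ab expr1n.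
(* All components commute with a, hence so does m * z, and then z itself since m is nonzero in D. *)
have mz : m%:R * z * a = a * (m%:R * z).
  by rewrite -sumz big_distrl big_distrr /=; apply: eq_bigr => i _.
have /torsion_mulf_eq0[m0|/eqP] : m%:R * (z * a - a * z) = 0.
- by rewrite mulrBr !mulrA mz mulrA (commr_nat a m) subrr.
- by have := torsion_order_neq0 m_gt0 am1 minm; rewrite m0 eqxx.
by rewrite subr_eq0 => /eqP.
Qed.

Lemma finite_torsion_powers x : finite_set (range (fun n => x ^+ n)).
Proof.
have [->|/torsion[m m_gt0 xm1]] := eqVneq x 0.
  apply: sub_finite_set (finite_set2 0 1) => _ [n _ <-] /=.
  by rewrite expr0n; case: n => [|n]; [right | left].
apply: sub_finite_set (finite_image (fun n => x ^+ n) (finite_II m)).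
by move=> _ [n _ <-]; exists (n %% m)%N; [exact: ltn_pmod | rewrite expr_mod].
Qed.

Lemma torsion_periodic : periodic D.
Proof.
move=> x; have [->|/torsion[n n_gt0 xn1]] := eqVneq x 0.
  by exists 1%N, 2%N; rewrite !expr0n.
exists 1%N, n.+1; rewrite (exprS x n) xn1 mulr1; split=> // -[n0].
by rewrite -n0 in n_gt0.
Qed.

(* Jacobson's theorem, reduced to Wedderburn's by [torsion_conjugate]. *)
Lemma torsion_mulrC : commutative ( *%R : D -> D -> D).
Proof.
move=> z a; have [->|a0] := eqVneq a 0; first by rewrite mulr0 mul0r.
apply: contrapT => za.
have [x [i [x0 xa aia]]] := torsion_conjugate a0 za.
(* The relation [x * a = a ^+ i * x] rewrites every word in a and x as some [a ^+ k * x ^+ l]; these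
   form a finite set closed under products. *)
pose M := [set u * v | u in range (fun n => a ^+ n) & v in range (fun n => x ^+ n)].
have MP k l : M (a ^+ k * x ^+ l).
  by exists (a ^+ k); [exists k | exists (x ^+ l); [exists l |]].
have xak k : x * a ^+ k = a ^+ (i * k) * x.
  elim: k => [|k IHk]; first by rewrite muln0 !expr0 mulr1 mul1r.
  by rewrite exprSr mulrA IHk -mulrA xa mulrA -exprD mulnS addnC.
have xlak l k : x ^+ l * a ^+ k = a ^+ (i ^ l * k) * x ^+ l.
  elim: l k => [|l IHl] k; first by rewrite expn0 mul1n !expr0 mulr1 mul1r.
  by rewrite exprSr -mulrA xak mulrA IHl -mulrA mulnA -expnSr.
have MM u v : M u -> M v -> M (u * v).
  move=> [_ [k _ <-] [_ [l _ <-] <-]] [_ [k' _ <-] [_ [l' _ <-] <-]].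
  rewrite mulrA -[a ^+ k * _ * _]mulrA xlak mulrA -exprD -mulrA -exprD.
  exact: MP.
have finM : finite_set M by apply: finite_image2; exact: finite_torsion_powers.
have [N N_gt0 DN] := periodic_mulrn torsion_periodic.
have /finite_seqP[s sE] := finite_rnggen_mulclosed N_gt0 DN MM finM.
have inP u : (u \in s) <-> rnggen M u by rewrite sE.
have clS : subring_closed [pred u in s].
  split=> [|u v /inP Mu /inP Mv|u v /inP Mu /inP Mv].
  - by apply/inP/rnggen_in; rewrite -[1]mulr1; exact: (MP 0%N 0%N).
  - by apply/inP/rnggenB.
  - by apply/inP/rnggenM.
have as_ : a \in s by apply/inP/rnggen_in; rewrite -[a]mulr1; exact: (MP 1%N 0%N).
have xs : x \in s by apply/inP/rnggen_in; rewrite -[x]mul1r; exact: (MP 0%N 1%N).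
(* In this finite subring x and a commute, so [(a ^+ i - a) * x = 0], against the choice of x and
   i. *)
have := finite_subring_comm (S := FiniteSubring clS) torsion_mulf_eq0 xs as_.
rewrite xa => /eqP; rewrite -subr_eq0 -mulrBl => /eqP.
case/torsion_mulf_eq0 => /eqP; last by rewrite (negPf x0).
by rewrite subr_eq0 => /eqP.
Qed.

(** By commutativity, products of powers of the generators are closed under multiplication, and each
    generator has finitely many powers. *)
Lemma torsion_locally_finite : locally_finite [set: D].
Proof.
move=> X _ /finite_seqP[s ->{X}].
suff [M [finM MM M1 sM]] : exists M : set D, [/\ finite_set M,
    forall x y, M x -> M y -> M (x * y), M 1 & [set` s] `<=` M].
  have [N N_gt0 DN] := periodic_mulrn torsion_periodic.
  exact: sub_finite_set (rnggen_mono sM) (finite_rnggen_mulclosed N_gt0 DN MM finM).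
elim: s => [|x s [M [finM MM M1 sM]]].
  exists [set 1]; split=> // _ _ -> ->.
  by rewrite /= mulr1.
exists [set u * v | u in range (fun n => x ^+ n) & v in M]; split.
- by apply: finite_image2 => //; exact: finite_torsion_powers.
- move=> _ _ [_ [k _ <-] [v Mv <-]] [_ [l _ <-] [w Mw <-]].
  exists (x ^+ (k + l)); first by exists (k + l)%N.
  exists (v * w); first exact: MM.
  by rewrite exprD -!mulrA (mulrA v) (torsion_mulrC v (x ^+ l)) -mulrA.
- by exists 1; [exists 0%N | exists 1; rewrite // mulr1].
move=> y /=; rewrite inE => /orP[/eqP->|sy].
  by exists x; [exists 1%N | exists 1; rewrite // mulr1].
by exists 1; [exists 0%N | exists y; [exact: sM | rewrite mul1r]].
Qed.

End TorsionDivisionRing.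

(** * The corner of a nonzero idempotent as a ring *)

Section CornerRing.
Variables (R : pzRingType) (e : R).

Definition corner_pred : {pred R} := fun x => (e * x == x) && (x * e == x).

Lemma corner_predP x : reflect (corner e x) (x \in corner_pred).
Proof. by apply: (iffP andP) => -[/eqP ? /eqP]. Qed.

Lemma corner_zmod_closed : zmod_closed corner_pred.
Proof.
split=> [|x y /corner_predP ex /corner_predP ey]; apply/corner_predP.
  exact: (corner_closed e).1.
exact: (corner_closed e).2.
Qed.

(** The proofs are parameters of the type so that its ring instance can retrieve them. *)
Definition corner_type & e * e = e & e != 0 : Type := {x : R | x \in corner_pred}.

Variables (ee : e * e = e) (e0 : e != 0).
Let E := corner_type ee e0.

HB.instance Definition _ := SubChoice.on E.
HB.instance Definition _ :=
  GRing.SubChoice_isSubZmodule.Build R corner_pred E corner_zmod_closed.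

Fact corner_one_subproof : e \in corner_pred.
Proof. by apply/corner_predP; split. Qed.

Fact corner_mul_subproof (x y : E) : val x * val y \in corner_pred.
Proof.
have [/corner_predP[ex _] /corner_predP[_ ye]] := (valP x, valP y).
by apply/corner_predP; split; rewrite ?mulrA ?ex -?mulrA ?ye.
Qed.

Definition corner_one : E := Sub e corner_one_subproof.
Definition corner_mul (x y : E) : E := Sub (val x * val y) (corner_mul_subproof x y).

Fact corner_mulA : associative corner_mul.
Proof. by move=> x y z; apply: val_inj; rewrite /= mulrA. Qed.
Fact corner_mul1l : left_id corner_one corner_mul.
Proof. by move=> x; apply: val_inj; case/corner_predP: (valP x). Qed.
Fact corner_mul1r : right_id corner_one corner_mul.
Proof. by move=> x; apply: val_inj; case/corner_predP: (valP x). Qed.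
Fact corner_mulDl : left_distributive corner_mul +%R.
Proof. by move=> x y z; apply: val_inj; rewrite /= mulrDl. Qed.
Fact corner_mulDr : right_distributive corner_mul +%R.
Proof. by move=> x y z; apply: val_inj; rewrite /= mulrDr. Qed.
Fact corner_one_neq0 : corner_one != 0.
Proof. by rewrite -val_eqE. Qed.

HB.instance Definition _ := GRing.Zmodule_isNzRing.Build E
  corner_mulA corner_mul1l corner_mul1r corner_mulDl corner_mulDr corner_one_neq0.

(** The exponent is positive because the identity of the corner is e rather than 1. *)
Lemma corner_valX (x : E) n : val (x ^+ n.+1) = val x ^+ n.+1.
Proof.
elim: n => [|n IHn]; first by rewrite !expr1.
by rewrite exprS [RHS]exprS -IHn.
Qed.

Lemma corner_periodic : periodic R -> periodic E.
Proof.
move=> perR x; have [[|m] [n [//]]] := perR (val x).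
case: n => // n _ _ mn xmn; exists m.+1, n.+1; split=> //.
by apply: val_inj; rewrite !corner_valX.
Qed.

Lemma corner_locally_finite :
  locally_finite [set: E] -> locally_finite (corner e).
Proof.
move=> finE X sX finX.
(* The default 0 of [insubd] is never taken, as X lies in the corner. *)
pose Y : set E := (insubd (0 : E)) @` X.
have finY : finite_set (rnggen Y) by apply: finE => //; exact: finite_image.
apply: sub_finite_set (finite_image val finY); apply: rnggen_sub.
- split=> [|_ _ [u Yu <-] [v Yv <-]]; first by exists 0 => //; exact: rnggen0.
  by exists (u - v) => //; exact: rnggenB.
- move=> _ _ [u Yu <-] [v Yv <-].
  by exists (u * v) => //; exact: rnggenM.
move=> x Xx; exists (insubd (0 : E) x); first by apply: rnggen_in; exists x.
by rewrite insubdK //; apply/corner_predP/sX.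
Qed.

End CornerRing.

(** Right inverses are two-sided, because the right inverse of y is x; then [x ^+ m] cancels from
    [x ^+ m = x ^+ n]. *)
Lemma periodic_division_torsion (D : nzRingType) : periodic D ->
    (forall x : D, x != 0 -> exists y, x * y = 1) ->
  forall x : D, x != 0 -> exists2 n, (0 < n)%N & x ^+ n = 1.
Proof.
move=> perD divD x x0.
have [y xy1] := divD x x0.
have yx1 : y * x = 1.
  have y0 : y != 0 by apply: contra_eq_neq xy1 => ->; rewrite mulr0 eq_sym oner_neq0.
  have [z yz1] := divD y y0.
  by rewrite -[x]mulr1 -yz1 (mulrA x) xy1 mul1r.
have [m [n [_ _ mn]]] := perD x; wlog ltmn : m n mn / (m < n)%N.
  move=> wl; case: (ltngtP m n) => // [lt|gt /esym]; first exact: wl lt.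
  by apply: wl gt => /esym.
move=> e; exists (n - m)%N; first by rewrite subn_gt0.
apply: (can_inj (g := *%R (y ^+ m)) (f := *%R (x ^+ m))) => [u|].
  by rewrite mulrA -exprMn_comm ?yx1 ?expr1n ?mul1r // /GRing.comm yx1 xy1.
by rewrite -exprD subnKC ?mulr1 // ltnW.
Qed.

(** * Semisimple periodic rings *)

Section Semisimple.
Variable R : pzRingType.
Hypothesis ssR : semisimple R.

(** Take f to be the component of 1 in I along a complement K: for u in I, [(1 - f) * u] lies in
    both I and K. *)
Lemma semisimple_left_unit (I : set R) : right_ideal I ->
  exists2 f, I f & forall u, I u -> f * u = u.
Proof.
move=> iI; have [K [iK IK0 decK]] := ssR iI.
have [f [g [If Kg fg1]]] := decK 1; exists f => // u Iu.
have : (I `&` K) (g * u).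
  split; last by case: iK => _ _; exact.
  rewrite (_ : g = 1 - f); last by rewrite fg1 addrC addKr.
  by case: (iI) => _ IB IM; rewrite mulrBl mul1r; apply: IB => //; exact: IM.
by rewrite IK0 -{3}[u]mul1r fg1 mulrDl => ->; rewrite addr0.
Qed.

(* Idempotents are well-founded, since the right annihilator of a decreasing
   chain of them has a left unit. *)
Lemma semisimple_minimal_idempotent (P : set R) e : e * e = e -> P e ->
  exists f, [/\ f * f = f, P f &
    forall g, g * g = g -> f * g = g -> g * f = g -> P g -> g = f].
Proof.
move=> ee Pe; apply: contrapT => nex.
have step f : exists g, f * f = f /\ P f ->
    [/\ g * g = g /\ P g, f * g = g, g * f = g & g <> f].
  have [[ff Pf]|] := pselect (f * f = f /\ P f); last by exists 0.
  apply: contrapT => /forallNP ng; apply: nex; exists f; split=> // g gg fg gf Pg.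
  by apply: contrapT => gNf; apply: (ng g) => _.
have [nx nxP] := choice step.
pose c := fix c n := if n is m.+1 then nx (c m) else e.
have cP n : c n * c n = c n /\ P (c n).
  by elim: n => [|n IHn] //=; have [] := nxP _ IHn.
have cS n : [/\ c n * c n.+1 = c n.+1, c n.+1 * c n = c n.+1 & c n.+1 <> c n].
  by have [] := nxP _ (cP n).
pose I := [set x | exists n, c n * x = 0].
have cD n k x : c n * x = 0 -> c (n + k)%N * x = 0.
  elim: k => [|k IHk] cx0; first by rewrite addn0.
  by rewrite addnS; have [_ <- _] := cS (n + k)%N; rewrite -mulrA IHk // mulr0.
have iI : right_ideal I.
  split=> [|x y [n cx] [m cy]|x r [n cx]]; first by exists 0%N; rewrite mulr0.
    exists (n + m)%N; rewrite mulrBr (cD n) // addnC (cD m) //.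
    by rewrite subrr.
  by exists n; rewrite mulrA cx mul0r.
(* Some [c n] kills f. As [1 - c n.+1] lies in I, it is fixed by f and so killed by [c n], which
   forces [c n = c n.+1]. *)
have [f [n cf0] fI] := semisimple_left_unit iI.
have [c1 c2 []] := cS n; apply/esym/eqP; rewrite -subr_eq0 -{1}[c n]mulr1.
rewrite -c1 -mulrBr -[1 - _]fI; first by rewrite mulrA cf0 mul0r.
by exists n.+1; rewrite mulrBr mulr1 (cP _).1 subrr.
Qed.

(** The right ideal xR has a left unit f = x * r. The idempotent [f * e] of the corner is nonzero
    since it fixes x, so it equals e, and [e * r * e] is the inverse sought. *)
Lemma semisimple_primitive_division (e x : R) : e * e = e ->
    (forall f, corner e f -> f * f = f -> f = 0 \/ f = e) ->
    corner e x -> x != 0 ->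
  exists2 y, corner e y & x * y = e.
Proof.
move=> ee prim [ex xe] x0.
have iI : right_ideal [set x * r | r in [set: R]].
  split=> [|_ _ [r _ <-] [s _ <-]|_ s [r _ <-]].
  - by exists 0; rewrite ?mulr0.
  - by exists (r - s); rewrite ?mulrBr.
  - by exists (r * s); rewrite ?mulrA.
have [f [r _ rf] fI] := semisimple_left_unit iI.
have ff : f * f = f by apply: fI; exists r.
have fx : f * x = x by apply: fI; exists 1; rewrite ?mulr1.
have ef : e * f = f by rewrite -rf mulrA ex.
have cfe : corner e (f * e) by split; rewrite ?mulrA ?ef // -mulrA ee.
have [||fe0|fe] := prim (f * e) => //.
- by rewrite mulrA -(mulrA f) ef ff.
- by case/eqP: x0; rewrite -fx -ex mulrA fe0 mul0r.
exists (e * r * e); first exact: cornerP.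
by rewrite !mulrA xe rf.
Qed.

(** Take a minimal idempotent e whose corner is not locally finite. A proper splitting of e into f
    and e - f would give two locally finite corners to glue, so e is primitive and its corner is a
    torsion division ring. *)
Lemma semisimple_locally_finite : periodic R -> locally_finite [set: R].
Proof.
move=> perR; have [N N_gt0 RN] := periodic_mulrn perR.
suff fin1 : locally_finite (corner (1 : R)).
  by move=> X _; apply: fin1 => x _; split; rewrite ?mul1r ?mulr1.
apply: contrapT => inf1.
have [e [ee infe mine]] := semisimple_minimal_idempotent
  (P := fun e => ~ locally_finite (corner e)) (mulr1 1) inf1.
apply: infe.
have [->|e0] := eqVneq e 0.
  move=> X sX _; apply: sub_finite_set (finite_set1 (0 : R)); apply: rnggen_sub.
  - by split=> //= x y -> ->; rewrite subrr.
  - by move=> x y /= -> _; rewrite mul0r.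
  - by move=> x /sX[<- _] /=; rewrite mul0r.
apply: contrapT => infe; apply: (infe).
have prim f : corner e f -> f * f = f -> f = 0 \/ f = e.
  move=> [ef fe] ff; apply: contrapT => /not_orP[f0 fNe].
  have good g : g * g = g -> corner e g -> g <> e -> locally_finite (corner g).
    by move=> gg [eg ge] gNe; apply: contrapT => infg; apply/gNe/mine.
  have gg : (e - f) * (e - f) = e - f.
    by rewrite mulrBl !mulrBr ee ef fe ff subrr subr0.
  apply: infe; rewrite -(subrK f e); apply: (locally_finite_cornerD N_gt0 RN) => //.
  - by rewrite mulrBl ef ff subrr.
  - by rewrite mulrBr fe ff subrr.
  - apply: good => //; first by split; rewrite ?mulrBr ?mulrBl ee ?ef ?fe.
    by move=> /eqP; rewrite subr_eq -subr_eq0 opprD addrA subrr sub0r oppr_eq0 => /eqP.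
  - exact: good.
apply: (corner_locally_finite (ee := ee) (e0 := e0)).
apply/torsion_locally_finite/periodic_division_torsion.
  exact: corner_periodic.
move=> x x0; have /corner_predP ex := valP x.
have [|y /corner_predP ey xy] := semisimple_primitive_division ee prim ex.
  by rewrite -val_eqE in x0.
by exists (Sub y ey); apply: val_inj.
Qed.

End Semisimple.

(** * Opposite rings, and perfect periodic rings *)

Lemma converse_prod (R : pzRingType) (I : Type) (s : seq I) (F : I -> R) :
  \prod_(i <- s) (F i : R^c) = \prod_(i <- rev s) F i.
Proof.
elim: s => [|i s IHs]; first by rewrite !big_nil.
by rewrite big_cons IHs rev_cons -cats1 big_cat big_seq1.
Qed.

Lemma converse_rnggen (R : pzRingType) (X : set R) :
  rnggen X `<=` rnggen (X : set R^c).
Proof.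
apply: rnggen_sub => [|x y Xx Xy|x]; first exact: (rnggen_closed (X : set R^c)).
  exact: (@rnggenM R^c X y x).
exact: (@rnggen_in R^c X).
Qed.

(** In the opposite ring the reversed products become ordinary ones, so the right-hand version
    applies there. *)
Lemma left_T_nilpotent_locally_finite (R : pzRingType) N (I : set R) :
    (0 < N)%N -> (forall x : R, x *+ N = 0) ->
    (forall a : nat -> R, (forall i, I (a i)) ->
      exists l, \prod_(i <- rev (index_iota 0 l)) a i = 0) ->
  locally_finite I.
Proof.
move=> N_gt0 RN Tnil X sXI finX; apply: sub_finite_set (converse_rnggen (X := X)) _.
apply: (@T_nilpotent_locally_finite R^c N N_gt0 RN I) => // a Ia.
by have [l al0] := Tnil a Ia; exists l; rewrite converse_prod.
Qed.

Lemma perfect_periodic_locally_finite (R : pzRingType) :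
    periodic R -> right_perfect R \/ left_perfect R ->
  locally_finite [set: R].
Proof.
move=> perR perf; have [N N_gt0 RN] := periodic_mulrn perR.
apply: (locally_finite_extension N_gt0 RN).
  case: perf => -[_ Tnil].
    apply: (T_nilpotent_locally_finite N_gt0 RN) => a Ja.
    (* Perfectness indexes sequences from 1, the T-nilpotence lemma from 0; hence [i.-1]. *)
    have [|l _ al0] := Tnil (fun i => a i.-1); first by move=> i _; exact: Ja.
    by exists l; move: al0; rewrite big_add1.
  apply: (left_T_nilpotent_locally_finite N_gt0 RN) => a Ja.
  have [|l _ al0] := Tnil (fun i => a i.-1); first by move=> i _; exact: Ja.
  exists l; rewrite -al0 /index_iota subn0 subSS subn0 -[1%N]/(1 + 0)%N iotaDl.
  by rewrite -map_rev big_map.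
apply: semisimple_locally_finite; first by case: perf => -[].
elim/quotW=> x; have [m [n [m0 n0 mn xmn]]] := perR x.
exists m, n; split=> //.
have piX k : (\pi_(jacobson_quot R) x) ^+ k = \pi_(jacobson_quot R) (x ^+ k).
  elim: k => [|k IHk]; first by rewrite !expr0 jacobson_quot_pi1.
  by rewrite !exprS IHk jacobson_quot_piM.
by rewrite !piX xmn.
Qed.

(** * Tensor products *)

Lemma tensor_periodic (k : comPzRingType) (A B : pzAlgType k) :
  periodic A -> locally_finite [set: A] -> locally_finite [set: B] ->
  periodic (tensor A B).
Proof.
move=> perA finA finB x; apply: finite_rnggen_periodic.
have [N N_gt0 AN] := periodic_mulrn perA.
have pure0 b : tensor_pure (0 : A) b = 0.
  by apply: (addrI (tensor_pure 0 b)); rewrite -tensor_pureDl !addr0.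
have pureMn b n : tensor_pure (1 *+ n : A) b = tensor_pure 1 b *+ n.
  by elim: n => [|n IHn]; rewrite ?mulr0n ?pure0 // !mulrS tensor_pureDl IHn.
(* The bound passes from A to the tensor product through [1 = tensor_pure 1 1]. *)
have TN (y : tensor A B) : y *+ N = 0.
  by rewrite -mulr_natl -tensor_pure1 -pureMn AN pure0 mul0r.
have [s ->] := tensor_sum x.
pose GA := rnggen [set` [seq y.1 | y <- s]].
pose GB := rnggen [set` [seq y.2 | y <- s]].
pose M := [set tensor_pure a b | a in GA & b in GB].
have finM : finite_set M.
  by apply: finite_image2; [apply: finA | apply: finB] => //; exact: finite_seq.
have MM y z : M y -> M z -> M (y * z).
  move=> [a Ga [b Gb <-]] [a' Ga' [b' Gb' <-]].
  exists (a * a'); first exact: rnggenM.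
  by exists (b * b'); [exact: rnggenM | rewrite tensor_pureM].
apply: finite_rnggen_sub (finite_rnggen_mulclosed N_gt0 TN MM finM) => _ ->.
rewrite big_seq; apply: add_closed_sum (rnggen_closed M) _ => y sy.
apply: rnggen_in; exists y.1; first by apply: rnggen_in; rewrite /= map_f.
by exists y.2 => //; apply: rnggen_in; rewrite /= map_f.
Qed.

Theorem theorem4p4 (k : comPzRingType) (A B : pzAlgType k)
    (hA : periodic A) (hB : periodic B)
    (hperfect : (right_perfect A /\ right_perfect B) \/
                (left_perfect A /\ left_perfect B)) :
  periodic (tensor A B).
Proof.
apply: tensor_periodic => //; apply: perfect_periodic_locally_finite => //.
  by case: hperfect => -[]; [left | right].
by case: hperfect => -[]; [left | right].
Qed.
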